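(* Let $f=\frac1n\sum_{i=1}^n f_i$ where each $f_i:\mathbb{R}^d\to\mathbb{R}$ is convex and $L_i$-smooth, and assume that $f$ is $\mu$-strongly convex ($\mu>0$) with minimizer $x^*$. Let $L_{\max}=\max_{1\le i\le n}L_i$, let $c\ge 1/2$, $\gamma_b\in(0,\infty)$, and put $\alpha:=\min\{\frac{1}{2cL_{\max}},\gamma_b\}$. Then the iterates of SGD with $\text{SPS}_{\max}$ (with parameters $c$ and $\gamma_b$) satisfy, for all $k\ge 0$, $$\mathbb{E}\|x^{k}-x^*\|^2\le (1-\mu\alpha)^k\|x^0-x^*\|^2+\frac{2\gamma_b\sigma^2}{\mu\alpha}.$$ Moreover, among all $c\ge 1/2$, the best convergence rate and the tightest neighborhood in this bound (that is, the smallest values of $1-\mu\alpha$ and of $\frac{2\gamma_b\sigma^2}{\mu\alpha}$) are obtained for $c=1/2$.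
   Context: Setting: $f(x)=\frac1n\sum_{i=1}^n f_i(x)$ is minimized over $\mathbb{R}^d$, and the set $\mathcal{X}^*$ of minimizers of $f$ is nonempty. A function is $L$-smooth if it is differentiable with $L$-Lipschitz gradient. For each $i$, $f_i^*:=\inf_x f_i(x)$, and it is assumed throughout that $\sigma^2:=\mathbb{E}_i[f_i(x^* )-f_i^*]=f(x^* )-\frac1n\sum_{i=1}^n f_i^*<\infty$ (so all $f_i^*$ are finite), where $x^*\in\mathcal{X}^*$. SGD: starting from a deterministic $x^0$, at each iteration $k$ an index $i\in\{1,\dots,n\}$ is drawn uniformly at random, independently of the past, and $x^{k+1}=x^k-\gamma_k\nabla f_i(x^k)$. $\text{SPS}_{\max}$ with parameters $c>0$ and $\gamma_b>0$: $\gamma_k=\min\left\{\frac{f_i(x^k)-f_i^*}{c\|\nabla f_i(x^k)\|^2},\gamma_b\right\}$, where $i$ is the index drawn at iteration $k$. If $\nabla f_i(x^k)=0$ then $x^{k+1}=x^k$. *)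

(* Defs.v *)
(* MathComp-Analysis, over an arbitrary R : realType. *)
From HB Require Import structures.
From mathcomp Require Export all_boot all_order all_algebra.
From mathcomp Require Export all_classical all_reals all_analysis.
Export numFieldNormedType.Exports.
Set Implicit Arguments.
Unset Strict Implicit.
Unset Printing Implicit Defensive.
Import Order.TTheory GRing.Theory Num.Theory.
Local Open Scope classical_set_scope.
Local Open Scope ring_scope.

Section Functions.
Context {R : realType} {d : nat}.
Implicit Types (h : 'rV[R]_d -> R) (x y u : 'rV[R]_d).

(* The library norm on 'rV[R]_d is the sup norm, which induces the same
   topology and the same notion of differentiability. *)
Definition enorm u : R := Num.sqrt (\sum_(j < d) u 0 j ^+ 2).

Definition grad h x : 'rV[R]_d := \row_(j < d) 'D_(delta_mx 0 j) h x.

Definition smooth (L : R) h : Prop :=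
  [/\ 0 <= L,
      forall x, differentiable h x
    & forall x y, enorm (grad h x - grad h y) <= L * enorm (x - y)].

Definition strongly_convex (mu : R) h : Prop :=
  forall (t : R) x y, 0 <= t <= 1 ->
    h (t *: x + (1 - t) *: y) <=
      t * h x + (1 - t) * h y
      - mu / 2 * (t * (1 - t)) * enorm (x - y) ^+ 2.

(* inf is a junk value unless range h has a lower bound. *)
Definition fstar h : R := inf (range h).

Definition sps_max (c gb : R) h x : R :=
  Num.min ((h x - fstar h) / (c * enorm (grad h x) ^+ 2)) gb.

Definition sps_step (c gb : R) h x : 'rV[R]_d :=
  if grad h x == 0 then x else x - sps_max c gb h x *: grad h x.

End Functions.

Section FiniteSum.
Context {R : realType} {d n : nat}.
Implicit Types (f : 'I_n -> 'rV[R]_d -> R).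

Definition favg f : 'rV[R]_d -> R :=
  fun x => n%:R^-1 * \sum_(i < n) f i x.

Definition sigma2 f (xs : 'rV[R]_d) : R :=
  favg f xs - n%:R^-1 * \sum_(i < n) fstar (f i).

(* The maximum of the L i when these are nonnegative. *)
Definition Lmax (L : 'I_n -> R) : R := \big[Num.max/0]_(i < n) L i.

Definition alpha (L : 'I_n -> R) (gb c : R) : R :=
  Num.min (1 / (2 * c * Lmax L)) gb.

Definition neighborhood f L (mu gb : R) (xs : 'rV[R]_d) (c : R) : R :=
  2 * gb * sigma2 f xs / (mu * alpha L gb c).

Fixpoint sgd_sps f (c gb : R) (x0 : 'rV[R]_d) (s : nat -> 'I_n) (k : nat)
    : 'rV[R]_d :=
  if k is k'.+1 then sps_step c gb (f (s k')) (sgd_sps f c gb x0 s k') else x0.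

End FiniteSum.

(* Random indices in 'I_n equipped with the discrete sigma-algebra: every
   subset B of 'I_n is an event. *)
Section Draws.
Context {R : realType} {disp : measure_display} {T : measurableType disp}.
Context (P : probability T R) {n : nat}.
Implicit Types idx : nat -> T -> 'I_n.

Definition mutually_independent idx : Prop :=
  forall (s : seq nat) (B : nat -> set 'I_n), uniq s ->
    P (\bigcap_(k in [set` s]) (idx k @^-1` B k)) =
      (\prod_(k <- s) P (idx k @^-1` B k))%E.

Definition iid_uniform idx : Prop :=
  [/\ forall k (B : set 'I_n), measurable (idx k @^-1` B),
      forall k (i : 'I_n), P (idx k @^-1` [set i]) = (n%:R^-1)%:E
    & mutually_independent idx].

End Draws.

(* Main.v *)
Require Import Defs.
From mathcomp Require Import lra ring.
Set Implicit Arguments.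
Unset Strict Implicit.
Unset Printing Implicit Defensive.
Import Order.TTheory GRing.Theory Num.Theory.
Local Open Scope classical_set_scope.
Local Open Scope ring_scope.

(** Fix a component [h] of the average, a point [x] with gradient [g] there,
    and the step size [s] that the stochastic Polyak rule chooses.  Expanding
    the square gives

      |x - s g - z|^2 = |x - z|^2 - 2 s <g, x - z> + s^2 |g|^2.

    The rule is designed so that the quadratic term is paid for by the
    suboptimality of [x]: [s c |g|^2 <= h x - inf h], and [2 c >= 1], so
    [s^2 |g|^2 <= 2 s (h x - inf h)].  The right-hand side then regroups as

      |x - z|^2 - 2 s (h z - h x - <g, z - x>) + 2 s (h z - inf h),

    in which the two brackets are nonnegative: the first is the Bregman
    divergence of a convex function, the second a suboptimality gap at [z].
    Hence [s] can be replaced by a lower bound in the first one and by an upper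
    bound in the second one.  The upper bound is [gb]; the lower bound is
    [alpha], because an [L]-smooth function that is bounded below satisfies
    [|g|^2 <= 2 L (h x - inf h)].  This is [sps_step_le].

    Both replacements are by constants that depend neither on [x] nor on the
    component, so the bound can be averaged over the components: the averaged
    Bregman divergence is that of the average, which strong convexity bounds
    below by [mu / 2 |x - z|^2], and the averaged gap is [sigma2].  This is the
    one-step contraction [sgd_sps_contract].

    The iterate after [k] draws is a function of these [k] indices, and the
    law of the first [k + 1] indices is uniform on a finite set.  So all
    expectations are finite sums ([expectation_draws_next]), and averaging over
    the last index turns the one-step bound into an affine recursion
    [e (k + 1) <= (1 - mu alpha) e k + 2 gb sigma2], which is solved by
    [affine_recursion].  Iterating needs [mu alpha <= 1], which comes from
    [mu <= Lmax] ([mu_le_Lmax]); that inequality requires a nonzero vector, so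
    dimension zero is treated apart.

    The optimality of [c = 1/2] holds because [alpha] decreases with [c]. *)

(** * Euclidean geometry and smooth convex functions *)

Section Euclid.
Context {R : realType} {d : nat}.
Implicit Types (h : 'rV[R]_d -> R) (x y u v : 'rV[R]_d).

Definition edot u v : R := \sum_(j < d) u 0 j * v 0 j.

Lemma enorm_ge0 u : 0 <= enorm u.
Proof. exact: sqrtr_ge0. Qed.

Lemma enorm_sqr u : enorm u ^+ 2 = edot u u.
Proof.
rewrite sqr_sqrtr; last by apply: sumr_ge0 => j _; exact: sqr_ge0.
by apply: eq_bigr => j _; rewrite expr2.
Qed.

Lemma edotC u v : edot u v = edot v u.
Proof. by apply: eq_bigr => j _; rewrite mulrC. Qed.

Lemma edotDl u v y : edot (u + v) y = edot u y + edot v y.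
Proof. by rewrite -big_split; apply: eq_bigr => j _; rewrite mxE mulrDl. Qed.

Lemma edotZl (a : R) u v : edot (a *: u) v = a * edot u v.
Proof. by rewrite mulr_sumr; apply: eq_bigr => j _; rewrite mxE mulrA. Qed.

Lemma edotNl u v : edot (- u) v = - edot u v.
Proof. by rewrite -scaleN1r edotZl mulN1r. Qed.

Lemma edotDr u v y : edot y (u + v) = edot y u + edot y v.
Proof. by rewrite !(edotC y) edotDl. Qed.

Lemma edotZr (a : R) u v : edot u (a *: v) = a * edot u v.
Proof. by rewrite !(edotC u) edotZl. Qed.

Lemma edotNr u v : edot u (- v) = - edot u v.
Proof. by rewrite !(edotC u) edotNl. Qed.

Definition edotE := (edotDl, edotDr, edotNl, edotNr, edotZl, edotZr).

Lemma enorm_eq0 u : (enorm u == 0) = (u == 0).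
Proof.
rewrite -sqrf_eq0 enorm_sqr; apply/eqP/eqP => [|->]; last first.
  by rewrite -(scale0r 0) edotZl mul0r.
move/psumr_eq0P => u0; apply/rowP => j; rewrite mxE; apply/eqP.
by rewrite -sqrf_eq0 expr2 u0// => i _; rewrite -expr2 sqr_ge0.
Qed.

(** Cauchy-Schwarz: the squared norm of [|v|^2 u - <u, v> v] is
    [|v|^2 (|u|^2 |v|^2 - <u, v>^2)], and it is nonnegative. *)
Lemma edot_le_enorm u v : edot u v <= enorm u * enorm v.
Proof.
have [/eqP|v0] := boolP (v == 0).
  move=> ->; rewrite -(scale0r 0) edotZr mul0r.
  by rewrite mulr_ge0 ?enorm_ge0.
have v1 : 0 < enorm v by rewrite lt_neqAle eq_sym enorm_eq0 v0 enorm_ge0.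
have [//|lt] := leP; exfalso.
have := enorm_sqr (enorm v ^+ 2 *: u - edot u v *: v).
rewrite !edotE (edotC v u) -!enorm_sqr => e.
have : 0 <= enorm (enorm v ^+ 2 *: u - edot u v *: v) ^+ 2 by exact: sqr_ge0.
rewrite e; have p : 0 <= enorm u by exact: enorm_ge0.
have : (enorm u * enorm v) ^+ 2 < edot u v ^+ 2.
  by rewrite ltrXn2r// ?mulr_ge0// ?enorm_ge0// ltW.
have : 0 < enorm v ^+ 2 by rewrite exprn_gt0.
nra.
Qed.

(** [grad] collects partial derivatives, which determine the other directional
    derivatives only because the differential is linear. *)
Lemma derive_grad h x v : differentiable h x -> 'D_v h x = edot (grad h x) v.
Proof.
move=> dh; rewrite deriveE// {1}[v]row_sum_delta linear_sum.
by apply: eq_bigr => j _; rewrite linearZ/= mxE deriveE// mulrC.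
Qed.

Lemma is_derive_line h x v (t : R) : differentiable h (x + t *: v) ->
  is_derive t 1 (fun s : R => h (x + s *: v)) (edot (grad h (x + t *: v)) v).
Proof.
move=> dh.
have E : (fun s : R => s^-1 *: (((fun s : R => h (x + s *: v)) \o shift t) (s *: (1:R))
           - h (x + t *: v))) =
         (fun s : R => s^-1 *: ((h \o shift (x + t *: v)) (s *: v) - h (x + t *: v))).
  apply/funext => s /=; congr (_ *: (h _ - _)).
  by rewrite scalerDl /GRing.scale/= mulr1 addrCA addrA.
split; rewrite -?derive_grad// /derivable /derive E//.
exact: diff_derivable.
Qed.

(** First-order form of strong convexity: divide the defining inequality at
    [t y + (1 - t) x] by [t] and let [t] decrease to 0.  The correction
    [mu / 2 t |y - x|^2] is subtracted from the difference quotient so that the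
    bound no longer depends on [t]. *)
Lemma strongly_convex_derive (mu : R) h x y :
  strongly_convex mu h -> derivable h x (y - x) ->
  'D_(y - x) h x <= h y - h x - mu / 2 * enorm (y - x) ^+ 2.
Proof.
move=> sc dh; set D := enorm _ ^+ 2.
pose q t : R := t^-1 *: ((h \o shift x) (t *: (y - x)) - h x).
have cq : (fun t : R => q t - mu / 2 * D * t) @ 0^'+ -->
    'D_(y - x) h x - mu / 2 * D * 0.
  apply: cvgB; first exact: cvg_dnbhs_at_right dh.
  apply: cvg_at_right_filter; apply: cvgM; first exact: cvg_cst.
  exact: cvg_id.
rewrite -['D_(y - x) h x]subr0 -[X in _ - X](mulr0 (mu / 2 * D)) -(cvg_lim _ cq)//.
apply: limr_le; first by apply/cvg_ex; eexists; exact: cq.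
near=> t.
have t0 : 0 < t by near: t; exact: nbhs_right_gt.
have t1 : t <= 1 by near: t; exact: nbhs_right_le.
have := sc t y x; rewrite (ltW t0) t1 -/D => /(_ isT) ht.
suff : q t <= h y - h x - mu / 2 * (1 - t) * D by lra.
rewrite /q /= /GRing.scale/= ler_pdivrMl//.
have -> : t *: (y - x) + x = t *: y + (1 - t) *: x.
  by rewrite scalerBr scalerBl scale1r addrAC addrA.
lra.
Unshelve. all: by end_near.
Qed.
Lemma enormZ (a : R) u : 0 <= a -> enorm (a *: u) = a * enorm u.
Proof.
move=> a0; apply/eqP; rewrite -(@eqrXn2 _ 2)// ?mulr_ge0 ?enorm_ge0//.
by rewrite exprMn !enorm_sqr !edotE mulrA expr2.
Qed.

(** Lets convex components and the strongly convex average share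
    [strongly_convex_derive]. *)
Lemma convex_strongly_convex0 h :
  convex_function [set: convex_lmodType 'rV[R]_d] h -> strongly_convex 0 h.
Proof.
move=> ch t x y /andP[t0 t1]; rewrite !mul0r subr0.
exact: (ch (Itv01 t0 t1) x y (mem_set I) (mem_set I)).
Qed.

(** Descent lemma.  Along the segment, the function minus its first-order
    model and minus the quadratic [L / 2 t^2 |v|^2] has derivative
    [<grad h (x + t v) - grad h x, v> - L t |v|^2 <= 0], hence is nonincreasing;
    this gives the constant [L / 2] without integration. *)
Lemma smooth_descent (L : R) h x v : smooth L h ->
  h (x + v) <= h x + edot (grad h x) v + L / 2 * enorm v ^+ 2.
Proof.
move=> [L0 dh lip]; set G := edot _ v; set D := enorm v ^+ 2.
pose phi (t : R) := h (x + t *: v) - (t * G + L / 2 * D * t ^+ 2).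
have dphi (t : R) :
    is_derive t 1 phi (edot (grad h (x + t *: v)) v - (G + L * D * t)).
  have dl := is_derive_line (dh (x + t *: v)).
  apply: is_deriveB.
  apply: is_derive_eq.
  rewrite /GRing.scale/=; lra.
have phi_cont : {within `[0, 1]%classic, continuous phi}.
  by apply: derivable_within_continuous => t _; exact: ex_derive.
have : phi 1 <= phi 0.
  apply: (@ler0_derive1_le_cc _ phi 0 1) => //; rewrite ?in_itv/= ?lexx ?ler01//.
  move=> t; rewrite in_itv/= => /andP[t0 _].
  rewrite derive1E derive_val.
  rewrite /G opprD addrA -edotNl -edotDl subr_le0.
  apply: le_trans (edot_le_enorm _ _) _.
  have := lip (x + t *: v) x; rewrite addrAC subrr add0r enormZ ?(ltW t0)//.
  have := enorm_ge0 v; rewrite /D; nra.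
rewrite /phi scale0r addr0 scale1r; lra.
Qed.

Lemma fstar_le h x : has_lbound (range h) -> fstar h <= h x.
Proof. by move=> lb; apply: ge_inf => //; exists x. Qed.

(** A gradient step of length [t] cannot go below the infimum, so the descent
    lemma bounds [(t - L / 2 t^2) |g|^2] by the gap.  The best choice is
    [t = 1 / L]; for [L = 0] the left-hand side is linear in [t], and a long
    enough step excludes a nonzero gradient. *)
Lemma smooth_grad_bound (L : R) h x : smooth L h -> has_lbound (range h) ->
  enorm (grad h x) ^+ 2 <= 2 * L * (h x - fstar h).
Proof.
move=> sh lb; set G := _ ^+ 2.
have key t : t * G - L / 2 * t ^+ 2 * G <= h x - fstar h.
  have := smooth_descent x (- t *: grad h x) sh.
  have := fstar_le (x + - t *: grad h x) lb.
  rewrite enorm_sqr !edotE -enorm_sqr -/G; lra.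
have [L0 _ _] := sh; have G0 : 0 <= G by exact: sqr_ge0.
have [Le|Ln0] := eqVneq L 0; last first.
  have := key L^-1; rewrite -(ler_pM2l (_ : 0 < 2 * L)); last lra.
  suff -> : 2 * L * (L^-1 * G - L / 2 * L^-1 ^+ 2 * G) = G by [].
  by field.
rewrite Le mulr0 mul0r leNgt; apply/negP => Gp.
have := key ((h x - fstar h + 1) / G).
rewrite Le divfK ?gt_eqF// !mul0r; lra.
Qed.

(** The step size is between [a] and [gb] wherever the gradient is nonzero,
    which gives the two replacements in the expanded square.  Where the gradient vanishes the point does
    not move, but then [x] minimizes [h], the Bregman divergence equals the gap
    at [z], and the bound follows from [a <= gb]. *)
Lemma sps_step_le (c gb a L : R) h x z :
  strongly_convex 0 h -> smooth L h -> has_lbound (range h) ->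
  1 / 2 <= c -> 0 <= gb -> 0 <= a <= gb -> (0 < L -> a <= 1 / (2 * c * L)) ->
  enorm (sps_step c gb h x - z) ^+ 2 <=
    enorm (x - z) ^+ 2 - 2 * a * (h z - h x - edot (grad h x) (z - x))
    + 2 * gb * (h z - fstar h).
Proof.
move=> ch sh lb c2 gb0 /andP[a0 agb] aL; have [L0 dh _] := sh.
have hz := fstar_le z lb; have hx := fstar_le x lb.
have breg0 : 0 <= h z - h x - edot (grad h x) (z - x).
  have := strongly_convex_derive ch (diff_derivable (v := z - x) (dh x)).
  rewrite derive_grad// !mul0r; lra.
rewrite /sps_step; case: ifPn => [/eqP g0|g0].
  have e0 : edot (grad h x) (z - x) = 0 by rewrite g0 -(scale0r 0) edotZl mul0r.
  rewrite e0 subr0 in breg0 *.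
  suff : fstar h = h x by move=> ->; nra.
  apply/eqP; rewrite eq_le hx/=; apply: lb_le_inf; first by exists (h x), x.
  move=> _ [y _ <-].
  have := strongly_convex_derive ch (diff_derivable (v := y - x) (dh x)).
  by rewrite derive_grad// g0 -(scale0r 0) edotZl !mul0r subr0 subr_ge0.
set g := grad h x; set s := sps_max c gb h x.
have G0 : 0 < enorm g ^+ 2.
  by rewrite exprn_gt0// lt_neqAle enorm_ge0 eq_sym enorm_eq0 g0.
have gL := smooth_grad_bound x sh lb; rewrite -/g in gL.
have Lp : 0 < L.
  rewrite lt_neqAle L0 andbT; apply: contraTneq gL => <-.
  by rewrite mulr0 mul0r -ltNge.
have cp : 0 < c by lra.
have cG : 0 < c * enorm g ^+ 2 by exact: mulr_gt0.
have sa : a <= s.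
  rewrite le_min agb andbT; apply: le_trans (aL Lp) _.
  rewrite ler_pdivrMr ?mulr_gt0// mulrAC ler_pdivlMr//; nra.
have sgb : s <= gb by rewrite ge_min lexx orbT.
have sG : s * (c * enorm g ^+ 2) <= h x - fstar h.
  by rewrite -ler_pdivlMr// ge_min lexx.
have -> : x - s *: g - z = (x - z) - s *: g by rewrite addrAC.
rewrite !enorm_sqr !edotE !(edotC _ x) !(edotC _ z) -!enorm_sqr.
have : s ^+ 2 * enorm g ^+ 2 <= 2 * s * (h x - fstar h) by nra.
rewrite !edotE !(edotC _ x) !(edotC _ z) in breg0 *; nra.
Qed.
End Euclid.

(** * Averaging over the components *)

Section Average.
Context {R : realType} {d n : nat}.
Context (f : 'I_n -> 'rV[R]_d -> R) (L : 'I_n -> R) (mu : R).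
Context (f_smooth : forall i, smooth (L i) (f i)).
Context (favg_sc : strongly_convex mu (favg f)).

Lemma is_derive_favg x v :
  is_derive x v (favg f) (n%:R^-1 * \sum_(i < n) edot (grad (f i) x) v).
Proof.
have df i : differentiable (f i) x by case: (f_smooth i).
have -> : favg f = n%:R^-1 *: \sum_(i < n) f i.
  by apply/funext => y; rewrite /favg fct_sumE.
apply: is_deriveZ; apply: is_derive_sum => i.
by rewrite -derive_grad//; apply/derivableP/diff_derivable.
Qed.

(** Stated with the component gradients, because this is the sum that
    averaging [sps_step_le] produces. *)
Lemma favg_strong_grad x y :
  n%:R^-1 * \sum_(i < n) edot (grad (f i) x) (y - x) <=
    favg f y - favg f x - mu / 2 * enorm (y - x) ^+ 2.
Proof.
have df := is_derive_favg x (y - x).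
by rewrite -(@derive_val _ _ _ _ _ _ _ df) strongly_convex_derive.
Qed.

Lemma le_Lmax i : L i <= Lmax L.
Proof. exact: le_bigmax. Qed.

Lemma Lmax_ge0 : 0 <= Lmax L.
Proof. exact: bigmax_ge_id. Qed.

(** For [x <> y], [<grad f x - grad f y, x - y>] is at least [mu |x - y|^2] by
    strong convexity and at most [Lmax |x - y|^2] by smoothness.  The points 0
    and a basis vector serve as [x] and [y]. *)
Lemma mu_le_Lmax : (0 < n)%N -> (0 < d)%N -> mu <= Lmax L.
Proof.
move=> n0 d0; have nR : 0 < n%:R :> R by rewrite ltr0n.
pose u : 'rV[R]_d := delta_mx 0 (Ordinal d0).
have u0 : 0 < enorm (u - 0) ^+ 2.
  rewrite exprn_gt0// subr0 lt_neqAle enorm_ge0 eq_sym enorm_eq0 andbT.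
  apply/eqP => /rowP/(_ (Ordinal d0)) /eqP.
  by rewrite !mxE !eqxx oner_eq0.
have h1 := favg_strong_grad 0 u; have h2 := favg_strong_grad u 0.
have e : enorm (0 - u) ^+ 2 = enorm (u - 0) ^+ 2.
  by rewrite -opprB !enorm_sqr edotNl edotNr opprK.
rewrite e -opprB in h2.
have : n%:R^-1 * \sum_(i < n) edot (grad (f i) u - grad (f i) 0) (u - 0) <=
       Lmax L * enorm (u - 0) ^+ 2.
  rewrite ler_pdivrMl// mulr_natl -[X in _ *+ X]card_ord -sumr_const.
  apply: ler_sum => i _; apply: le_trans (edot_le_enorm _ _) _.
  have [_ _ /(_ u 0) lip] := f_smooth i.
  have := le_Lmax i; have := enorm_ge0 (u - 0); nra.
have -> : \sum_(i < n) edot (grad (f i) u - grad (f i) 0) (u - 0) =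
  - \sum_(i < n) edot (grad (f i) u) (- (u - 0)) - \sum_(i < n) edot (grad (f i) 0) (u - 0).
  rewrite -!sumrN -big_split/=; apply: eq_bigr => i _; rewrite !edotE; ring.
move=> h3; rewrite -(ler_pM2r u0); lra.
Qed.

(** What the contraction needs from [alpha]: it lies below every step size, and
    it is small enough that [mu * alpha] is at most 1.  With [1 / 0 = 0], all three bounds survive the degenerate case [Lmax L = 0],
    where [alpha] is 0. *)
Lemma alpha_bounds c gb : 0 < c -> 0 <= gb ->
  [/\ 0 <= alpha L gb c <= gb,
      forall i, 0 < L i -> alpha L gb c <= 1 / (2 * c * L i)
    & alpha L gb c * (c * Lmax L) <= 1 / 2].
Proof.
move=> c0 gb0; have L0 := Lmax_ge0; split.
- rewrite /alpha le_min ge_min lexx orbT gb0 !andbT.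
  by rewrite divr_ge0// !mulr_ge0// ltW.
- move=> i Li; rewrite ge_min; apply/orP; left.
  rewrite !div1r lef_pV2 ?posrE ?mulr_gt0//; last exact: lt_le_trans (le_Lmax i).
  by rewrite ler_pM2l ?le_Lmax// mulr_gt0.
- have [->|Ln0] := eqVneq (Lmax L) 0; first by rewrite !mulr0 divr_ge0.
  have Lp : 0 < Lmax L by rewrite lt_neqAle eq_sym Ln0.
  rewrite -ler_pdivlMr ?mulr_gt0// ge_min; apply/orP; left.
  rewrite le_eqVlt; apply/orP; left; apply/eqP; field.
  by rewrite Ln0 gt_eqF.
Qed.

Lemma alpha_gt0 c gb : 0 < c -> 0 < gb -> 0 < Lmax L -> 0 < alpha L gb c.
Proof.
by move=> c0 gb0 L0; rewrite lt_min gb0 andbT divr_gt0// !mulr_gt0.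
Qed.

Lemma alpha_anti c c' gb : 0 < c -> c <= c' -> alpha L gb c' <= alpha L gb c.
Proof.
move=> c0 cc'; rewrite le_min; apply/andP; split; last by rewrite ge_min lexx orbT.
rewrite ge_min; apply/orP; left.
have [->|Ln0] := eqVneq (Lmax L) 0; first by rewrite !mulr0.
have Lp : 0 < Lmax L by rewrite lt_neqAle eq_sym Ln0 Lmax_ge0.
have c'0 : 0 < c' by exact: lt_le_trans cc'.
by rewrite !div1r lef_pV2 ?posrE ?mulr_gt0// ler_pM2r// ler_pM2l.
Qed.

Context (f_convex : forall i, strongly_convex 0 (f i)).
Context (f_lbound : forall i, has_lbound (range (f i))).

Lemma sigma2_ge0 z : 0 <= sigma2 f z.
Proof.
rewrite /sigma2 /favg -mulrBr -sumrB mulr_ge0 ?invr_ge0//.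
by apply: sumr_ge0 => i _; rewrite subr_ge0 fstar_le.
Qed.

(** The expected effect of one step, conditionally on the current point. *)
Lemma sgd_sps_contract c gb x z : (0 < n)%N -> 1 / 2 <= c -> 0 <= gb ->
  n%:R^-1 * \sum_(i < n) enorm (sps_step c gb (f i) x - z) ^+ 2 <=
    (1 - mu * alpha L gb c) * enorm (x - z) ^+ 2 + 2 * gb * sigma2 f z.
Proof.
move=> n0 c2 gb0; have nR : 0 < n%:R :> R by rewrite ltr0n.
have c0 : 0 < c by lra.
have [a0gb aL _] := alpha_bounds c0 gb0; set a := alpha L gb c in a0gb aL *.
have step i : enorm (sps_step c gb (f i) x - z) ^+ 2 <=
    enorm (x - z) ^+ 2 - 2 * a * (f i z - f i x - edot (grad (f i) x) (z - x))
    + 2 * gb * (f i z - fstar (f i)).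
  exact: (sps_step_le x z (f_convex i) (f_smooth i) (f_lbound i) c2 gb0 a0gb (aL i)).
have sg := favg_strong_grad x z.
have e : enorm (z - x) ^+ 2 = enorm (x - z) ^+ 2.
  by rewrite -opprB !enorm_sqr edotNl edotNr opprK.
rewrite e in sg.
apply: (@le_trans _ _ (n%:R^-1 * \sum_(i < n) (enorm (x - z) ^+ 2
    - 2 * a * (f i z - f i x - edot (grad (f i) x) (z - x))
    + 2 * gb * (f i z - fstar (f i))))).
  by rewrite ler_pM2l ?invr_gt0//; apply: ler_sum => i _; exact: step.
rewrite big_split sumrB/= sumr_const card_ord -!mulr_sumr !sumrB.
have nV D : n%:R^-1 * (D *+ n) = D :> R.
  by rewrite -(mulr_natr D) mulrCA mulVf ?gt_eqF// mulr1.
rewrite mulrDr mulrBr nV.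
case/andP: a0gb => a0 _; have := ler_wpM2l a0 sg.
rewrite /sigma2 /favg; lra.
Qed.

End Average.

(** * The law of the drawn indices *)

Section FiniteLaw.
Context {R : realType} {disp : measure_display} {T : measurableType disp}.
Context (P : probability T R).

Lemma expectation_finite (I : finType) (Y : T -> I) (p H : I -> R) :
  (forall i, measurable (Y @^-1` [set i])) ->
  (forall i, P (Y @^-1` [set i]) = (p i)%:E) ->
  ('E_P[fun w => H (Y w)] = ((\sum_i H i * p i)%R)%:E)%E.
Proof.
move=> mY pY; rewrite unlock.
transitivity (\int[P]_w (\sum_i (H i)%:E * (\1_(Y @^-1` [set i]) w)%:E))%E.
  apply: eq_integral => w _.
  rewrite (bigD1 (Y w))//= big1 ?adde0 => [|i iY].
    by rewrite indicE mem_set// mule1.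
  by rewrite indicE memNset ?mule0// => /= e; rewrite e eqxx in iY.
rewrite integral_sum//= => [|i]; last first.
  exact/integrableZl/integrable_indic.
rewrite -sumEFin; apply: eq_bigr => i _.
rewrite integralZl//; last exact: integrable_indic.
by rewrite integral_indic// setIT EFinM -pY.
Qed.

Context {n : nat} (idx : nat -> T -> 'I_n).
Context (idx_iid : iid_uniform P idx).

Definition draws k (w : T) : k.-tuple 'I_n := [tuple idx j w | j < k].

Lemma nth_draws i0 k w j : (j < k)%N -> nth i0 (draws k w) j = idx j w.
Proof.
by move=> jk; rewrite -[j in LHS]/(nat_of_ord (Ordinal jk)) -tnth_nth tnth_mktuple.
Qed.

(** Expresses an event on the pair (first [k] indices, next index) in the form
    to which mutual independence applies. *)
Lemma draws_next_cylinder k (s : k.-tuple 'I_n) i :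
  (fun w => (draws k w, idx k w)) @^-1` [set (s, i)] =
  \bigcap_(j in [set` iota 0 k.+1]) (idx j @^-1` [set nth i (rcons s i) j]).
Proof.
have -> : [set` iota 0 k.+1] = [set j | (j < k.+1)%N].
  by apply/funext => j; rewrite /mkset mem_iota.
apply/seteqP; split => w.
  move=> [<- <-] j; rewrite /mkset ltnS leq_eqVlt nth_rcons size_tuple.
  by case: ltngtP => // [jk _|-> _]; rewrite ?nth_draws.
move=> ws; congr pair; last first.
  by have /= := ws k (ltnSn k); rewrite nth_rcons size_tuple ltnn eqxx.
apply: eq_from_tnth => j; rewrite tnth_mktuple (tnth_nth i).
have /= := ws j (ltnW (ltn_ord j : (j.+1 < k.+1)%N)).
by rewrite nth_rcons size_tuple ltn_ord.
Qed.

(** The first [k] indices are kept apart from the next one, so that the inner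
    sum is the conditional average over the fresh index.  With [G] constant in
    its second argument the same formula gives expectations that depend on the
    first [k] indices only. *)
Lemma expectation_draws_next k (G : k.-tuple 'I_n -> 'I_n -> R) :
  ('E_P[fun w => G (draws k w) (idx k w)] =
    (\sum_s \sum_i G s i * n%:R^-1 ^+ k.+1)%R%:E)%E.
Proof.
have [midx unif indep] := idx_iid.
rewrite pair_bigA/=.
apply: (@expectation_finite _ (fun w => (draws k w, idx k w))
  (fun=> n%:R^-1 ^+ k.+1) (fun q => G q.1 q.2)) => -[s i].
  rewrite draws_next_cylinder.
  by apply: fin_bigcap_measurable => // j _; exact: midx.
rewrite draws_next_cylinder indep ?iota_uniq//.
rewrite (eq_bigr (fun=> (n%:R^-1)%:E)) => [|j _]; last exact: unif.
by rewrite prodEFin (prodr_const_nat 0 k.+1).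
Qed.

End FiniteLaw.

(** * From one step to all steps *)

Section Recursion.
Context {R : realType} {d n : nat}.
Implicit Types (f : 'I_n -> 'rV[R]_d -> R).

(** The iterate is adapted: only the indices already drawn matter. *)
Lemma eq_sgd_sps f c gb x0 (s s' : nat -> 'I_n) k :
  (forall j, (j < k)%N -> s j = s' j) ->
  sgd_sps f c gb x0 s k = sgd_sps f c gb x0 s' k.
Proof.
elim: k => [//|k ih] ss /=; rewrite (ss k (ltnSn k)); congr (sps_step _ _ _ _).
by apply: ih => j jk; apply: ss; exact: ltnW.
Qed.

Lemma sgd_spsS f c gb x0 s k :
  sgd_sps f c gb x0 s k.+1 = sps_step c gb (f (s k)) (sgd_sps f c gb x0 s k).
Proof. by []. Qed.

(** The constant [C / q] is the fixed point of [t |-> (1 - q) t + C]; the bound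
    [q <= 1] makes this map monotone. *)
Lemma affine_recursion (e : nat -> R) (q C : R) :
  0 < q <= 1 -> 0 <= C -> (forall k, e k.+1 <= (1 - q) * e k + C) ->
  forall k, e k <= (1 - q) ^+ k * e 0 + C / q.
Proof.
move=> /andP[q0 q1] C0 rec; elim=> [|k ih].
  by rewrite expr0 mul1r lerDl divr_ge0// ltW.
apply: le_trans (rec k) _; rewrite exprS.
have := ler_wpM2l (_ : 0 <= 1 - q) ih; rewrite subr_ge0 => /(_ q1).
have -> : (1 - q) * ((1 - q) ^+ k * e 0 + C / q) =
   (1 - q) * (1 - q) ^+ k * e 0 + C / q - C by field; rewrite gt_eqF.
lra.
Qed.

End Recursion.
Theorem theorem3p1
  (R : realType) (d n : nat) (hn : (0 < n)%N)
  (f : 'I_n -> 'rV[R]_d -> R) (L : 'I_n -> R)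
  (f_convex : forall i, convex_function [set: convex_lmodType 'rV[R]_d] (f i))
  (f_smooth : forall i, smooth (L i) (f i))
  (f_lbound : forall i, has_lbound (range (f i)))
  (mu : R) (mu_gt0 : 0 < mu) (f_strongly_convex : strongly_convex mu (favg f))
  (xs : 'rV[R]_d) (xs_min : forall x, favg f xs <= favg f x)
  (gb : R) (gb_gt0 : 0 < gb) (x0 : 'rV[R]_d)
  (disp : measure_display) (T : measurableType disp) (P : probability T R)
  (idx : nat -> T -> 'I_n) (idx_iid : iid_uniform P idx) :
  (forall c : R, 1 / 2 <= c -> forall k : nat,
    ('E_P[fun w => (enorm (sgd_sps f c gb x0 (idx ^~ w) k - xs) ^+ 2)%R] <=
      ((1 - mu * alpha L gb c) ^+ k * enorm (x0 - xs) ^+ 2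
       + neighborhood f L mu gb xs c)%:E)%E)
  /\ (forall c : R, 1 / 2 <= c ->
       1 - mu * alpha L gb (1 / 2) <= 1 - mu * alpha L gb c
       /\ neighborhood f L mu gb xs (1 / 2) <= neighborhood f L mu gb xs c).
Proof.
have sconv i := convex_strongly_convex0 (f_convex i).
have gb0 := ltW gb_gt0.
have S0 : 0 <= sigma2 f xs by exact: sigma2_ge0.
have C0 : 0 <= 2 * gb * sigma2 f xs by rewrite !mulr_ge0.
split=> [c c2 k|c c2]; have c0 : 0 < c by lra.
  have [/andP[a0 _] _ aL] := alpha_bounds L c0 gb0.
  (* In dimension zero [mu * alpha] may exceed 1, but all norms vanish. *)
  have [d0|d0] := posnP d.
    have n0 (u : 'rV[R]_d) : enorm u = 0.
      rewrite /enorm big1 ?sqrtr0// => j _.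
      by have := ltn_ord j; rewrite [X in (_ < X)%N]d0.
    rewrite (_ : (fun w => _) = cst 0); last first.
      by apply/funext => w; rewrite n0 expr0n.
    rewrite expectation_cst lee_fin n0 expr0n mulr0 add0r.
    by rewrite divr_ge0// mulr_ge0// ltW.
  have muL := mu_le_Lmax f_smooth f_strongly_convex hn d0.
  have ap : 0 < alpha L gb c by apply: alpha_gt0 => //; lra.
  (* [X] is kept abstract: only its dependence on the first [j] draws matters. *)
  have [X XE] : exists X : forall j, j.-tuple 'I_n -> 'rV[R]_d,
      forall j w, sgd_sps f c gb x0 (idx ^~ w) j = X j (draws idx j w).
    exists (fun j s => sgd_sps f c gb x0 (nth (Ordinal hn) s) j) => j w.
    by apply: eq_sgd_sps => l lj; rewrite nth_draws.
  pose e k := \sum_(s : k.-tuple 'I_n) \sum_(i < n)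
    enorm (X k s - xs) ^+ 2 * n%:R^-1 ^+ k.+1.
  have eE j : ('E_P[fun w => (enorm (sgd_sps f c gb x0 (idx ^~ w) j - xs) ^+ 2)%R]
      = (e j)%:E)%E.
    under eq_fun do rewrite XE.
    exact: (expectation_draws_next idx_iid (fun s _ => enorm (X j s - xs) ^+ 2)).
  have e0 : e 0%N = enorm (x0 - xs) ^+ 2.
    by apply: EFin_inj; rewrite -eE /= expectation_cst.
  rewrite eE lee_fin -e0; apply: affine_recursion => //.
    rewrite mulr_gt0//= mulrC; apply: le_trans (ler_wpM2l a0 muL) _.
    have := ler_wpM2r (mulr_ge0 a0 (Lmax_ge0 L)) c2; lra.
  move=> j.
  (* The additive constant of the one-step bound is averaged as well, against
     weights of total mass 1. *)
  have mass : \sum_(s : j.-tuple 'I_n) \sum_(i < n) 1 * n%:R^-1 ^+ j.+1 = 1 :> R.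
    apply: EFin_inj.
    by rewrite -(expectation_draws_next idx_iid (fun _ _ => 1)) expectation_cst.
  have -> : e j.+1 = \sum_(s : j.-tuple 'I_n) \sum_(i < n)
      enorm (sps_step c gb (f i) (X j s) - xs) ^+ 2 * n%:R^-1 ^+ j.+1.
    apply: EFin_inj; rewrite -eE.
    under eq_fun do rewrite sgd_spsS XE.
    exact: (expectation_draws_next idx_iid
      (fun s i => enorm (sps_step c gb (f i) (X j s) - xs) ^+ 2)).
  apply: (@le_trans _ _ ((1 - mu * alpha L gb c) * e j + 2 * gb * sigma2 f xs *
      \sum_(s : j.-tuple 'I_n) \sum_(i < n) 1 * n%:R^-1 ^+ j.+1)); last first.
    by rewrite mass mulr1.
  rewrite /e !mulr_sumr -big_split/=.
  apply: ler_sum => s _; rewrite !mulr_sumr -big_split/=.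
  under [leRHS]eq_bigr do rewrite mul1r mulrA -mulrDl.
  rewrite -!mulr_suml ler_wpM2r ?exprn_ge0 ?invr_ge0//.
  rewrite sumr_const card_ord -[_ *+ n]mulr_natl -ler_pdivrMl ?ltr0n//.
  exact: (sgd_sps_contract f_smooth f_strongly_convex sconv f_lbound).
have h0 : 0 < 1 / 2 :> R by lra.
have le_a : alpha L gb c <= alpha L gb (1 / 2) by exact: alpha_anti.
split; first by rewrite lerD2l lerN2 ler_pM2l.
rewrite /neighborhood ler_wpM2l//.
(* If [Lmax L] is 0, then [alpha] is the same for all [c], as [1 / 0 = 0]. *)
have [L0|Ln0] := eqVneq (Lmax L) 0.
  by rewrite /alpha L0 !mulr0.
have Lp : 0 < Lmax L by rewrite lt_neqAle eq_sym Ln0 Lmax_ge0.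
by rewrite lef_pV2 ?posrE ?mulr_gt0 ?alpha_gt0// ler_pM2l.
Qed.
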